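(* Let $(X,d)$ be a metric space and $f:X\to X$ a continuous map. If $(X,f)$ is chain-mixing and has the shadowing property, then it is strongly multi-$\beta$-$n$-sensitive, i.e. it is multi-$\beta$-$n$-sensitive for every $n\in\mathbb{N}$ with $n\geq 2$ and every $\beta\in\mathbb{N}^n$.
   Context: $\mathbb{N}=\{1,2,3,\dots\}$. - For $\varepsilon>0$, an $\varepsilon$-chain of length $q$ from $x$ to $y$ is a sequence $x=x_0,x_1,\dots,x_q=y$ in $X$ with $d(f(x_i),x_{i+1})<\varepsilon$ for $0\le i<q$. $(X,f)$ is chain-mixing if for every $\varepsilon>0$ and all $x,y\in X$ there is $N\in\mathbb{N}$ such that for every $q\geq N$ there is an $\varepsilon$-chain of length $q$ from $x$ to $y$. - $(X,f)$ has the shadowing property if for every $\varepsilon>0$ there is $\eta>0$ such that for every sequence $(x_i)_{i\geq0}$ in $X$ with $d(f(x_i),x_{i+1})<\eta$ for all $i\ge0$ there is $z\in X$ with $d(f^i(z),x_i)<\varepsilon$ for all $i\geq 0$. - For $\beta=(b_1,\dots,b_n)\in\mathbb{N}^n$, $U\subseteq X$, $\delta>0$, let $N_f(U,\beta,\delta)=\{k\in\mathbb{N}:\exists x_1,\dots,x_n\in U \text{ with } \min_{1\leq i<j\leq n}d(f^{b_ik}(x_i),f^{b_jk}(x_j))>\delta\}$. $(X,f)$ is multi-$\beta$-$n$-sensitive if there is $\delta>0$ such that for every $m\in\mathbb{N}$ and all nonempty open $U_1,\dots,U_m\subseteq X$, $\bigcap_{i=1}^mN_f(U_i,\beta,\d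elta)\neq\emptyset$.
   Formalization: The formal theorem additionally assumes that X is not a one-point space; on a single point the identity is chain-mixing and has shadowing, but all distances are 0, so the claim fails. *)

(* Defs.v *)
From HB Require Import structures.
From mathcomp Require Import all_boot all_order all_algebra.
From mathcomp Require Import all_classical all_reals all_analysis.

Set Implicit Arguments.
Unset Strict Implicit.
Unset Printing Implicit Defensive.

Import Order.TTheory GRing.Theory Num.Theory.

Local Open Scope classical_set_scope.
Local Open Scope ring_scope.

(* Here the set of natural numbers is {1, 2, 3, ...}, hence the positivity
   conditions on N, k, m and the entries of beta below. *)

(* Only the values s 0, ..., s q matter. *)
Definition eps_chain (R : realType) (X : metricType R) (f : X -> X)
    (eps : R) (q : nat) (x y : X) (s : nat -> X) : Prop :=
  [/\ s 0%N = x, s q = y &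
      forall i : nat, (i < q)%N -> mdist (f (s i)) (s i.+1) < eps].

Definition chain_mixing (R : realType) (X : metricType R) (f : X -> X) : Prop :=
  forall eps : R, 0 < eps -> forall x y : X,
  exists2 N : nat, (0 < N)%N &
  forall q : nat, (N <= q)%N -> exists s : nat -> X, eps_chain f eps q x y s.

Definition shadowing (R : realType) (X : metricType R) (f : X -> X) : Prop :=
  forall eps : R, 0 < eps -> exists2 eta : R, 0 < eta &
  forall x : nat -> X,
    (forall i : nat, mdist (f (x i)) (x i.+1) < eta) ->
    exists z : X, forall i : nat, mdist (iter i f z) (x i) < eps.

(* The minimum is taken in the extended reals so that +oo is its neutral
   element; for 2 <= n it ranges over a nonempty set of pairs and is finite. *)
Definition sep_times (R : realType) (X : metricType R) (f : X -> X) (n : nat)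
    (U : set X) (beta : 'I_n -> nat) (delta : R) : set nat :=
  [set k : nat | (0 < k)%N /\
    exists2 x : 'I_n -> X, (forall i, U (x i)) &
    (delta%:E <
     \big[Order.min/+oo]_(p : 'I_n * 'I_n | (p.1 < p.2)%N)
       (mdist (iter (beta p.1 * k) f (x p.1))
              (iter (beta p.2 * k) f (x p.2)))%:E)%E].

Definition multi_sensitive (R : realType) (X : metricType R) (f : X -> X)
    (n : nat) (beta : 'I_n -> nat) : Prop :=
  exists2 delta : R, 0 < delta &
  forall (m : nat) (U : 'I_m -> set X), (0 < m)%N ->
    (forall i, open (U i)) -> (forall i, U i !=set0) ->
    \bigcap_(i in [set: 'I_m]) sep_times f (U i) beta delta !=set0.

Definition strongly_multi_sensitive (R : realType) (X : metricType R)
    (f : X -> X) : Prop :=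
  forall (n : nat) (beta : 'I_n -> nat), (2 <= n)%N ->
    (forall i, (0 < beta i)%N) -> multi_sensitive f beta.

(* Main.v *)
Require Import Defs.
From mathcomp Require Import all_boot all_order all_algebra.
From mathcomp Require Import all_classical all_reals all_analysis.
From mathcomp Require Import lra.

(* Shadowing turns the pseudo-orbits provided by chain mixing into true orbits,
   so f is topologically mixing: every nonempty open set visits every ball at
   all large times.  A chain-mixing space with at least two points is infinite,
   because on a finite space fine chains are orbits, and one orbit cannot sit
   at two points at the same time.  Hence there are n distinct points; at a
   large time k every U_j meets the preimages, under f^(b_i k), of small
   disjoint balls around them. *)

Set Implicit Arguments.
Unset Strict Implicit.
Unset Printing Implicit Defensive.

Import Order.TTheory GRing.Theory Num.Theory.

Local Open Scope classical_set_scope.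
Local Open Scope ring_scope.

Section ChainMixing.
Context {R : realType} {X : metricType R}.
Variable f : X -> X.

(** The least distance between distinct entries works; starting the minimum at [1] keeps it positive
    when there is no such pair. *)
Lemma seq_separated (s : seq X) : exists2 e : R, 0 < e &
  {in s &, forall x y, mdist x y < e -> x = y}.
Proof.
pose ss := [seq (x, y) | x <- s, y <- s].
exists (\big[Num.min/1]_(p <- ss | p.1 != p.2) mdist p.1 p.2).
  apply: (big_ind (fun e : R => 0 < e)) => //.
  - by move=> a b a0 b0; rewrite lt_min a0.
  - by move=> p; rewrite mdist_gt0.
move=> x y xs ys xye; apply/eqP; apply: contraPT xye => xy; apply/negP.
rewrite -leNgt.
by apply: (ge_bigmin_seq _ (x, y)) => //; apply: allpairs_f.
Qed.

Lemma chain_mixing_infinite : chain_mixing f ->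
  (exists x y : X, x != y) -> forall n, exists t : n.-tuple X, uniq t.
Proof.
move=> f_mix [a [b ab]]; elim=> [|n [t ut]]; first by exists [tuple].
have [[x xt]|tX] := pselect (exists x, x \notin t).
  by exists (cons_tuple x t); rewrite /= xt.
have {}tX x : x \in t by apply: contrapT => xt; apply: tX; exists x; apply/negP.
have [e e0 te] := seq_separated t.
(* Both [f (s i)] and [s i.+1] lie in [t], so an error below [e] is zero. *)
have chain_iter q x y s : eps_chain f e q x y s -> iter q f x = y.
  move=> [<- <- H].
  suff K i : (i <= q)%N -> iter i f (s 0%N) = s i by exact: K.
  elim: i => // i IH iq; rewrite iterS IH ?(ltnW iq)//.
  by apply: te => //; exact: H.
have [Na _ Ha] := f_mix _ e0 a a.
have [Nb _ Hb] := f_mix _ e0 a b.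
have [sa /chain_iter fa] := Ha _ (leq_maxl Na Nb).
have [sb /chain_iter fb] := Hb _ (leq_maxr Na Nb).
by move/eqP: ab; rewrite -fa {1}fb.
Qed.

Lemma shadowing_mixing : chain_mixing f -> shadowing f ->
  forall (U : set X) (y : X) (d : R), open U -> U !=set0 -> 0 < d ->
  exists N, forall q, (N <= q)%N -> exists2 z, U z & mdist (iter q f z) y < d.
Proof.
move=> f_mix f_shadow U y d oU [x Ux] d0.
have /nbhs_ballP[r /= r0 rU] : nbhs x U by exact: open_nbhs_nbhs.
have e0 : 0 < Num.min r d by rewrite lt_min r0.
have [eta eta0 Heta] := f_shadow _ e0.
have [N _ HN] := f_mix _ eta0 x y.
exists N => q /HN[s [s0 sq Hs]].
(* Shadowing needs an infinite sequence: after time [q] the chain continues as the true orbit of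
   [y], without error. *)
pose u i := if (i <= q)%N then s i else iter (i - q) f y.
have [i|z Hz] := Heta u.
  rewrite /u; case: (ltngtP i q) => [iq|qi|->]; first exact: Hs.
  - by rewrite subSn ?(ltnW qi)// iterS mdistxx.
  - by rewrite subSnn sq mdistxx.
exists z.
  apply: rU; rewrite -metricType_numDomainType.ball_mdistE /= metric_sym.
  by have := Hz 0%N; rewrite /u /= s0 lt_min => /andP[].
by have := Hz q; rewrite /u leqnn sq lt_min => /andP[].
Qed.

End ChainMixing.

(* [not_point] excludes exactly the one-point spaces, on which the claim fails. *)
Theorem theorem10 (R : realType) (X : metricType R) (f : X -> X)
  (not_point : ~ exists x : X, forall y : X, y = x)
  (f_cont : continuous f)
  (f_mix : chain_mixing f)
  (f_shadow : shadowing f) :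
  strongly_multi_sensitive f.
Proof.
move=> n beta _ beta0.
have [[a _]|X0] := pselect (exists x : X, True); last first.
  (* The empty space has no nonempty open set, so any constant serves. *)
  by exists 1 => // m U m0 _ /(_ (Ordinal m0))[x _]; case: X0; exists x.
have [b ab] : exists b, a != b.
  apply: contrapT => H; apply: not_point; exists a => y.
  by apply/eqP; rewrite eq_sym; apply: contrapT => /negP ay; apply: H; exists y.
have ab' : exists x y : X, x != y by exists a, b.
have [t /tuple_uniqP t_inj] := chain_mixing_infinite f_mix ab' n.
have [e e0 te] := seq_separated t.
(* Points within [e / 4] of targets at least [e] apart stay more than [e / 2] apart. *)
exists (e / 4) => [|m U _ oU U0]; first by lra.
have e40 : 0 < e / 4 by lra.
have /choice[N HN] (p : 'I_m * 'I_n) := shadowing_mixing f_mix f_shadow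
  (tnth t p.2) (oU p.1) (U0 p.1) e40.
(* The successor makes the time [k] positive; since [beta i] is at least 1, [beta i * k] exceeds
   every [N p]. *)
exists (\max_p N p).+1 => j _; split=> //.
set k := (\max_p N p).+1.
have /choice[x Hx] i : exists z, U j z /\
    mdist (iter (beta i * k) f z) (tnth t i) < e / 4.
  have [|z Uz zi] := HN (j, i) (beta i * k)%N; last by exists z.
  apply: (leq_trans (leq_bigmax (j, i))).
  by apply: (leq_trans (leqnSn _)); rewrite leq_pmull.
exists x => [i|]; first by have [] := Hx i.
apply: (big_ind (fun z : \bar R => ((e / 4)%:E < z)%E)).
- exact: ltry.
- by move=> u v eu ev; rewrite lt_min eu.
move=> [i i'] /= ii'; rewrite lte_fin.
have [_ Hi] := Hx i; have [_ Hi'] := Hx i'.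
have : e <= mdist (tnth t i) (tnth t i').
  rewrite leNgt; apply/negP => /(te _ _ (mem_tnth _ _) (mem_tnth _ _))/t_inj E.
  by rewrite E ltnn in ii'.
set p := iter _ f _ in Hi *; set q := iter _ f _ in Hi' *.
have := metric_triangle (tnth t i) p (tnth t i').
have := metric_triangle p q (tnth t i').
rewrite (metric_sym (tnth t i) p); lra.
Qed.
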